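(* Let $(M^3,\Phi,\xi,\eta,g)$ be a Lorentzian Sasakian $3$-manifold and let $\alpha:I\to M$ be a non-geodesic contact whirl curve with Frenet frame $\{T,N,B\}$, causal characters $\varepsilon_1=g(T,T)$, $\varepsilon_2=g(N,N)$, $\varepsilon_3=g(B,B)$, curvature $\kappa>0$ and torsion $\tau$, satisfying $\eta(T)=\varrho\,\eta(N)$ along $\alpha$ for a constant $\varrho\neq 0$. Assume that on an open interval $J\subset I$ one has $\eta(T)\neq 0$, $\tau\neq 1$, and $$A:=\varepsilon_1+\frac{\varepsilon_2}{\varrho^2}\neq 0.$$ Then the torsion satisfies on $J$ $$\tau'=(\tau-1)\left(\frac{\varepsilon_2\varepsilon_3}{\varrho\,\kappa\,A}(\tau-1)^2+\frac{\kappa'}{\kappa}+\frac{\varepsilon_2}{\varrho}\kappa\right).$$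
   Context: A contact metric Lorentzian $3$-manifold $(M,\eta,\xi,g,\Phi)$ is a smooth $3$-manifold with a contact form $\eta$, Reeb vector field $\xi$ ($\eta(\xi)=1$, $d\eta(\xi,\cdot)=0$), a Lorentzian metric $g$ with $g(\xi,\xi)=-1$, and a $(1,1)$-tensor $\Phi$ with $\Phi^2=-\mathrm{id}+\eta\otimes\xi$, $g(\Phi X,\Phi Y)=g(X,Y)+\eta(X)\eta(Y)$ and $d\eta(X,Y)=g(X,\Phi Y)$, where $d\eta(X,Y)=\tfrac12\bigl(X\eta(Y)-Y\eta(X)-\eta([X,Y])\bigr)$. In particular $\eta(X)=-g(X,\xi)$, $\eta\circ\Phi=0$, and, with $\nabla$ the Levi-Civita connection of $g$ and $h=\frac12\mathcal L_\xi\Phi$, one has $\nabla_X\xi=\Phi X-\Phi hX$. It is Lorentzian Sasakian if $\xi$ is Killing (equivalently $h=0$); then $\nabla_X\xi=\Phi X$ and $(\nabla_X\Phi)Y=g(X,Y)\xi+\eta(Y)X$. The vector product is $X\wedge Y=g(X,\Phi Y)\xi-\eta(Y)\Phi X+\eta(X)\Phi Y$. A (non-geodesic) Frenet curve is a unit-speed non-null curve $\alpha$, with $T=\alpha'$ and $g(T,T)=\varepsilon_1\in\{\pm1\}$, such that $\nabla_TT$ is non-null. It has an orthonormal Frenet frame $\{T,N,B\}$, with $g(N,N)=\varepsilon_2$, $g(B,B)=\varepsilon_3$, $\varepsilon_1\varepsilon_2=-\varepsilon_3$, oriented so that $T\wedge N=\varepsilon_3B$, $N\wedge B=\varepsilon_1T$,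 $B\wedge T=\varepsilon_2N$, and satisfying $$\nabla_TT=\varepsilon_2\kappa N,\quad \nabla_TN=-\varepsilon_1\kappa T-\varepsilon_3\tau B,\quad \nabla_TB=\varepsilon_2\tau N,$$ with curvature $\kappa>0$ and torsion $\tau$. Primes denote derivatives with respect to the arc-length parameter. The curve is a contact whirl curve if there is a constant $\varrho\neq0$ with $\eta(T)=\varrho\,\eta(N)$ along $\alpha$. *)

(* Defs.v *)
From HB Require Import structures.
From mathcomp Require Import all_boot all_order all_algebra.
From mathcomp Require Import all_classical all_reals all_analysis.
Import Order.TTheory GRing.Theory Num.Theory.
Import numFieldNormedType.Exports.

Set Implicit Arguments.
Unset Strict Implicit.
Unset Printing Implicit Defensive.

Local Open Scope classical_set_scope.
Local Open Scope ring_scope.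

(* MathComp-Analysis has no manifolds. A smooth manifold is given here by an
   atlas, and tensor fields by their components in every chart, subject to
   smoothness and to the classical law of change of coordinates. Vectors are
   row vectors (as in the library's Jacobian ''J', for which
   'd f x v = v *m 'J f x), covectors are column vectors, a bilinear form b is
   (u, v) |-> u *m b *m v^T and an endomorphism F is u |-> u *m F. *)

Section Smooth.
Context {R : realType} {V W : normedModType R}.

(* C^oo on an open set U: every iterated directional derivative is
   differentiable at every point of U. *)
Definition smooth_on (U : set V) (f : V -> W) : Prop :=
  forall (s : seq V) (x : V), U x ->
    differentiable (foldr (fun v (h : V -> W) y => 'D_v h y) f s) x.

End Smooth.

Record manifold (R : realType) (n : nat) := Manifold {
  point_of :> topologicalType;
  manifold_hausdorff : hausdorff_space point_of;
  manifold_second_countable : @second_countable point_of;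
  chart : Type;
  dom : chart -> set point_of;
  chart_map : chart -> point_of -> 'rV[R]_n;
  (* inverse of chart_map c; only its values on chart_map c @` dom c matter *)
  chart_inv : chart -> 'rV[R]_n -> point_of;
  dom_cover : forall p : point_of, exists c, dom c p;
  dom_open : forall c, open (dom c);
  img_open : forall c, open (chart_map c @` dom c);
  chart_mapK : forall c p, dom c p -> chart_inv c (chart_map c p) = p;
  chart_map_continuous : forall c p, dom c p -> {for p, continuous (chart_map c)};
  chart_inv_continuous : forall c x, (chart_map c @` dom c) x ->
    {for x, continuous (chart_inv c)};
  transition_smooth : forall c d,
    smooth_on (chart_map c @` (dom c `&` dom d)) (chart_map d \o chart_inv c) }.

Arguments chart {R n} M : rename.
Arguments dom {R n M} c : rename.
Arguments chart_map {R n M} c p : rename.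
Arguments chart_inv {R n M} c x : rename.

Section Tensors.
Context {R : realType} {n : nat}.

Definition img (M : manifold R n) (c : chart M) : set 'rV[R]_n :=
  chart_map c @` dom c.

Definition overlap (M : manifold R n) (c d : chart M) : set 'rV[R]_n :=
  chart_map c @` (dom c `&` dom d).

Definition transition (M : manifold R n) (c d : chart M) :
  'rV[R]_n -> 'rV[R]_n := chart_map d \o chart_inv c.

Record vectorField (M : manifold R n) := VectorField {
  vf_comp :> chart M -> 'rV[R]_n -> 'rV[R]_n;
  vf_smooth : forall c, smooth_on (img c) (vf_comp c);
  vf_change : forall c d x, overlap c d x ->
    vf_comp d (transition c d x) = vf_comp c x *m 'J (transition c d) x }.

Record oneForm (M : manifold R n) := OneForm {
  of_comp :> chart M -> 'rV[R]_n -> 'cV[R]_n;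
  of_smooth : forall c, smooth_on (img c) (of_comp c);
  of_change : forall c d x, overlap c d x ->
    of_comp c x = 'J (transition c d) x *m of_comp d (transition c d x) }.

Record bilinearField (M : manifold R n) := BilinearField {
  bf_comp :> chart M -> 'rV[R]_n -> 'M[R]_n;
  bf_smooth : forall c, smooth_on (img c) (bf_comp c);
  bf_change : forall c d x, overlap c d x ->
    bf_comp c x = 'J (transition c d) x *m bf_comp d (transition c d x)
                  *m ('J (transition c d) x)^T }.

Record endoField (M : manifold R n) := EndoField {
  ef_comp :> chart M -> 'rV[R]_n -> 'M[R]_n;
  ef_smooth : forall c, smooth_on (img c) (ef_comp c);
  ef_change : forall c d x, overlap c d x ->
    ef_comp c x *m 'J (transition c d) x =
    'J (transition c d) x *m ef_comp d (transition c d x) }.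

Definition eval1 (w : 'cV[R]_n) (u : 'rV[R]_n) : R := (u *m w) 0 0.

Definition eval2 (b : 'M[R]_n) (u v : 'rV[R]_n) : R := (u *m b *m v^T) 0 0.

Definition partial (i : 'I_n) (f : 'rV[R]_n -> R) (x : 'rV[R]_n) : R :=
  'D_(delta_mx 0 i) f x.

(* With the factor 1/2:
   d eta (X, Y) = (X (eta Y) - Y (eta X) - eta [X, Y]) / 2,
   evaluated on coordinate vector fields, whose brackets vanish. *)
Definition extd (M : manifold R n) (eta : oneForm M) (c : chart M)
    (x : 'rV[R]_n) : 'M[R]_n :=
  \matrix_(i, j) (2^-1 * (partial i (fun y => eta c y j 0) x -
                          partial j (fun y => eta c y i 0) x)).

(* (L_X b)_ij = X^k d_k b_ij + b_kj d_i X^k + b_ik d_j X^k *)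
Definition lie_bilinear (M : manifold R n) (X : vectorField M)
    (b : bilinearField M) (c : chart M) (x : 'rV[R]_n) : 'M[R]_n :=
  \matrix_(i, j) \sum_(k < n)
    (X c x 0 k * partial k (fun y => b c y i j) x
     + b c x k j * partial i (fun y => X c y 0 k) x
     + b c x i k * partial j (fun y => X c y 0 k) x).

Definition killing (M : manifold R n) (g : bilinearField M)
    (X : vectorField M) : Prop :=
  forall (c : chart M) x, img c x -> lie_bilinear X g c x = 0.

(* Christoffel symbol Gamma^k_ij of the Levi-Civita connection of g *)
Definition christoffel (M : manifold R n) (g : bilinearField M) (c : chart M)
    (x : 'rV[R]_n) (k i j : 'I_n) : R :=
  2^-1 * \sum_(l < n) invmx (g c x) k l *
    (partial i (fun y => g c y j l) x + partial j (fun y => g c y i l) x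
     - partial l (fun y => g c y i j) x).

(* A curve is a total function R -> M, only considered on an open interval I. *)

Definition curve_dom (M : manifold R n) (I : set R) (alpha : R -> M)
    (c : chart M) : set R := I `&` alpha @^-1` dom c.

Definition smooth_curve (M : manifold R n) (I : set R) (alpha : R -> M) : Prop :=
  (forall t, I t -> {for t, continuous alpha}) /\
  (forall c, smooth_on (curve_dom I alpha c) (chart_map c \o alpha)).

(* Components V c t, in each chart c with alpha t in its domain, of a smooth
   vector field along alpha *)
Definition field_along (M : manifold R n) (I : set R) (alpha : R -> M)
    (V : chart M -> R -> 'rV[R]_n) : Prop :=
  (forall c, smooth_on (curve_dom I alpha c) (V c)) /\
  (forall c d t, curve_dom I alpha c t -> curve_dom I alpha d t ->
     V d t = V c t *m 'J (transition c d) (chart_map c (alpha t))).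

Definition velocity (M : manifold R n) (alpha : R -> M) (c : chart M) (t : R) :
  'rV[R]_n := derive1 (chart_map c \o alpha) t.

Definition cov_deriv (M : manifold R n) (g : bilinearField M) (alpha : R -> M)
    (V : chart M -> R -> 'rV[R]_n) (c : chart M) (t : R) : 'rV[R]_n :=
  \row_k (derive1 (V c) t 0 k +
    \sum_(i < n) \sum_(j < n) christoffel g c (chart_map c (alpha t)) k i j *
      velocity alpha c t 0 i * V c t 0 j).

End Tensors.

Section Contact.
Context {R : realType}.

(* Symmetric of signature (-,+,+) at every point *)
Definition lorentzian (M : manifold R 3) (g : bilinearField M) : Prop :=
  forall (c : chart M) x, img c x ->
    (g c x)^T = g c x /\
    exists2 P : 'M[R]_3, P \in unitmx &
      P *m g c x *m P^T = diag_mx (\row_(i < 3) (if i == 0 then -1 else 1)).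

(* eta /\ d eta <> 0; up to a nonzero constant, its value on the coordinate
   frame is the sum below. Addition in 'I_3 is modulo 3, so the sum is
   cyclic. *)
Definition contact_form (M : manifold R 3) (eta : oneForm M) : Prop :=
  forall (c : chart M) x, img c x ->
    \sum_(i < 3) eta c x i 0 * extd eta c x (i + 1) (i + 2%:R) != 0.

Record contactMetricLorentzian (M : manifold R 3) := ContactMetricLorentzian {
  eta : oneForm M;
  xi : vectorField M;
  metric : bilinearField M;
  Phi : endoField M;
  cml_contact : contact_form eta;
  cml_eta_xi : forall c x, img c x -> eval1 (eta c x) (xi c x) = 1;
  cml_deta_xi : forall c x u, img c x -> eval2 (extd eta c x) (xi c x) u = 0;
  cml_lorentzian : lorentzian metric;
  cml_xi_timelike : forall c x, img c x ->
    eval2 (metric c x) (xi c x) (xi c x) = -1;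
  cml_Phi2 : forall c x (u : 'rV[R]_3), img c x ->
    u *m Phi c x *m Phi c x = - u + eval1 (eta c x) u *: xi c x;
  cml_compatible : forall c x u v, img c x ->
    eval2 (metric c x) (u *m Phi c x) (v *m Phi c x) =
    eval2 (metric c x) u v + eval1 (eta c x) u * eval1 (eta c x) v;
  cml_deta : forall c x u v, img c x ->
    eval2 (extd eta c x) u v = eval2 (metric c x) u (v *m Phi c x) }.

Definition sasakian (M : manifold R 3) (S : contactMetricLorentzian M) : Prop :=
  killing (metric S) (xi S).

Definition wedge (M : manifold R 3) (S : contactMetricLorentzian M)
    (c : chart M) (x u v : 'rV[R]_3) : 'rV[R]_3 :=
  eval2 (metric S c x) u (v *m Phi S c x) *: xi S c x
  - eval1 (eta S c x) v *: (u *m Phi S c x)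
  + eval1 (eta S c x) u *: (v *m Phi S c x).

Section Along.
Variables (M : manifold R 3) (S : contactMetricLorentzian M) (alpha : R -> M).
Implicit Types (V W : chart M -> R -> 'rV[R]_3).

Definition eta_along V (c : chart M) (t : R) : R :=
  eval1 (eta S c (chart_map c (alpha t))) (V c t).

Definition g_along V W (c : chart M) (t : R) : R :=
  eval2 (metric S c (chart_map c (alpha t))) (V c t) (W c t).

Definition wedge_along V W (c : chart M) (t : R) : 'rV[R]_3 :=
  wedge S c (chart_map c (alpha t)) (V c t) (W c t).

End Along.

Record frenet_curve (M : manifold R 3) (S : contactMetricLorentzian M)
    (I : set R) (alpha : R -> M) (N B : chart M -> R -> 'rV[R]_3)
    (e1 e2 e3 : R) (kappa tau : R -> R) : Prop := FrenetCurve {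
  fc_smooth : smooth_curve I alpha;
  fc_N : field_along I alpha N;
  fc_B : field_along I alpha B;
  fc_e1 : e1 = 1 \/ e1 = -1;
  fc_e2 : e2 = 1 \/ e2 = -1;
  fc_e3 : e3 = 1 \/ e3 = -1;
  fc_e123 : e1 * e2 = - e3;
  fc_kappa : forall t, I t -> 0 < kappa t;
  fc_causal : forall c t, curve_dom I alpha c t ->
    [/\ g_along S alpha (velocity alpha) (velocity alpha) c t = e1,
        g_along S alpha N N c t = e2 & g_along S alpha B B c t = e3];
  fc_orthogonal : forall c t, curve_dom I alpha c t ->
    [/\ g_along S alpha (velocity alpha) N c t = 0,
        g_along S alpha (velocity alpha) B c t = 0 &
        g_along S alpha N B c t = 0];
  fc_oriented : forall c t, curve_dom I alpha c t ->
    [/\ wedge_along S alpha (velocity alpha) N c t = e3 *: B c t,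
        wedge_along S alpha N B c t = e1 *: velocity alpha c t &
        wedge_along S alpha B (velocity alpha) c t = e2 *: N c t];
  fc_nonnull : let DT := cov_deriv (metric S) alpha (velocity alpha) in
    forall c t, curve_dom I alpha c t -> g_along S alpha DT DT c t != 0;
  fc_frenet : forall c t, curve_dom I alpha c t ->
    [/\ cov_deriv (metric S) alpha (velocity alpha) c t =
          (e2 * kappa t) *: N c t,
        cov_deriv (metric S) alpha N c t =
          - (e1 * kappa t) *: velocity alpha c t - (e3 * tau t) *: B c t &
        cov_deriv (metric S) alpha B c t = (e2 * tau t) *: N c t] }.

Definition contact_whirl (M : manifold R 3) (S : contactMetricLorentzian M)
    (I : set R) (alpha : R -> M) (N : chart M -> R -> 'rV[R]_3) (rho : R) :
    Prop :=
  rho != 0 /\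
  forall c t, curve_dom I alpha c t ->
    eta_along S alpha (velocity alpha) c t = rho * eta_along S alpha N c t.

End Contact.

(* Main.v *)
Require Import Defs.
From mathcomp Require Import all_boot all_order all_algebra.
From mathcomp Require Import all_classical all_reals all_analysis.
From mathcomp Require Import ring lra.
Import Order.TTheory GRing.Theory Num.Theory.
Import numFieldNormedType.Exports.

(** Write a, b, d for eta evaluated on the Frenet vectors T, N, B of the curve.

    On a Sasakian manifold the covariant derivative of eta is d eta: its
    antisymmetric part always is, the Levi-Civita connection being
    torsion-free, and its symmetric part vanishes because eta is, up to sign,
    the metric dual of the Killing field xi ([killing_christoffel],
    [sasakian_nabla_eta]). Hence, for every field V along the curve,
    (eta V)' = eta (D V) + d eta (T, V) ([is_derive_eta_along]). The extra term
    is read off the orientation of the frame, because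
    eta (u /\ v) = d eta (u, v) ([eta_wedge]), and the Frenet equations become
    the linear system ([frenet_eta])

      a' = e2 kappa b,  b' = - e1 kappa a - e3 (tau - 1) d,
      d' = e2 (tau - 1) b.

    Differentiating the whirl condition a = rho b and comparing with this
    system gives the algebraic relation d (tau - 1) = - e3 A kappa a. Since
    its right-hand side does not vanish, d does not either, the relation can
    be solved for tau, and one more differentiation gives the
    claim ([whirl_torsion_ode]).

    Neither kappa nor tau is known to be differentiable beforehand. For tau
    this follows from the relation just mentioned; for kappa it follows from
    a' = e2 kappa b, where b has no zero and a is twice differentiable, being
    built from the smooth components of eta and of the velocity
    ([derivable_dpairing]). *)

Set Implicit Arguments.
Unset Strict Implicit.

Local Open Scope classical_set_scope.
Local Open Scope ring_scope.

(** * Derivatives of component functions along curves *)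

Section Calculus.
Context {R : realType}.

Lemma differentiable_entry {V : normedModType R} m n (f : V -> 'M[R]_(m, n)) x i j :
  differentiable f x -> differentiable (fun y => f y i j) x.
Proof.
by move=> df; apply: (@differentiable_comp _ _ _ _ f
  (fun N : 'M[R]_(m, n) => N i j : R)) => //; exact: differentiable_coord.
Qed.

Lemma derive_entry {V : normedModType R} m n (f : V -> 'M[R]_(m, n)) x v i j :
  differentiable f x -> 'D_v f x i j = 'D_v (fun y => f y i j) x.
Proof. by move=> /diff_derivable df; rewrite derive_mx ?mxE. Qed.

Lemma is_derive_entry m n (f : R -> 'M[R]_(m, n)) t i j :
  differentiable f t -> is_derive t (1 : R) (fun y => f y i j) (derive1 f t i j).
Proof.
move=> df; rewrite derive1E derive_entry//; apply: derivableP.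
exact/diff_derivable/differentiable_entry.
Qed.

(** The chain rule, with the differential of f expanded on the standard basis. *)
Lemma is_derive_comp_curve n (f : 'rV[R]_n -> R) (x : R -> 'rV[R]_n) t :
  differentiable x t -> differentiable f (x t) ->
  is_derive t (1 : R) (f \o x) (\sum_j derive1 x t 0 j * partial j f (x t)).
Proof.
move=> dx df; apply: DeriveDef.
  exact/diff_derivable/differentiable_comp.
rewrite deriveE; last exact: differentiable_comp.
rewrite diff_comp//= -derive1E'// {1}[derive1 x t]row_sum_delta linear_sum.
by apply: eq_bigr => j _; rewrite linearZ /partial deriveE.
Qed.

(** A sum of functions is the function returning the sum only up to
    extensionality; this is [is_derive_sum] for the latter. *)
Lemma is_derive_sum_fun n (h : 'I_n -> R -> R) (dh : 'I_n -> R) (t : R) :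
  (forall i, is_derive t (1 : R) (h i) (dh i)) ->
  is_derive t (1 : R) (fun s => \sum_i h i s) (\sum_i dh i).
Proof.
move=> dhi; have -> : (fun s => \sum_i h i s) = \sum_i h i; last exact: is_derive_sum.
by apply/funext => s; rewrite fct_sumE.
Qed.

Lemma is_derive_mul (f g : R -> R) t (df dg : R) :
  is_derive t (1 : R) f df -> is_derive t (1 : R) g dg ->
  is_derive t (1 : R) (fun s => f s * g s) (df * g t + f t * dg).
Proof.
move=> hf hg; apply: (is_derive_eq (is_deriveM hf hg)).
by rewrite addrC [g t *: _]mulrC.
Qed.

Lemma is_derive_inj (f : R -> R) t (l l' : R) :
  is_derive t (1 : R) f l -> is_derive t (1 : R) f l' -> l = l'.
Proof. by move=> [_ <-] [_ <-]. Qed.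

(** The derivative of s |-> w (x s) (V s), as an explicit polynomial in first
    derivatives: in this form it can visibly be differentiated once more. *)
Definition dpairing {n} (w : 'rV[R]_n -> 'cV[R]_n) (x V : R -> 'rV[R]_n) (s : R) : R :=
  \sum_i (derive1 V s 0 i * w (x s) i 0 +
    V s 0 i * \sum_j derive1 x s 0 j * 'D_(delta_mx 0 j) w (x s) i 0).

Lemma is_derive_pairing n (w : 'rV[R]_n -> 'cV[R]_n) (x V : R -> 'rV[R]_n) t :
  differentiable w (x t) -> differentiable x t -> differentiable V t ->
  is_derive t (1 : R) (fun s => eval1 (w (x s)) (V s)) (dpairing w x V t).
Proof.
move=> dw dx dV.
have -> : (fun s => eval1 (w (x s)) (V s)) = (fun s => \sum_i V s 0 i * w (x s) i 0).
  by apply/funext => s; rewrite /eval1 mxE.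
apply: is_derive_sum_fun => i; apply: is_derive_mul; first exact: is_derive_entry.
under eq_bigr do rewrite derive_entry//.
apply: (@is_derive_comp_curve _ (fun y => w y i 0)) => //.
exact: differentiable_entry.
Qed.

Lemma derivable_dpairing n (w : 'rV[R]_n -> 'cV[R]_n) (x V : R -> 'rV[R]_n) t :
  (forall v, differentiable ('D_v w) (x t)) -> differentiable w (x t) ->
  differentiable x t -> differentiable (derive1 x) t ->
  differentiable V t -> differentiable (derive1 V) t ->
  derivable (dpairing w x V) t (1 : R).
Proof.
move=> ddw dw dx ddx dV ddV.
suff [dh hd] : exists dh, is_derive t (1 : R) (dpairing w x V) dh by [].
rewrite /dpairing; eexists.
apply: is_derive_sum_fun => i; apply: is_deriveD.
  apply: is_derive_mul; first exact: is_derive_entry.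
  apply: (@is_derive_comp_curve _ (fun y => w y i 0)) => //.
  exact: differentiable_entry.
apply: is_derive_mul; first exact: is_derive_entry.
apply: is_derive_sum_fun => j; apply: is_derive_mul; first exact: is_derive_entry.
apply: (@is_derive_comp_curve _ (fun y => 'D_(delta_mx 0 j) w y i 0)) => //.
exact: differentiable_entry.
Qed.

End Calculus.

(** * Bilinear algebra and the Sasakian identities in a chart *)

Section BilinearAlgebra.
Context {R : realType}.

Lemma eval2_sum n (b : 'M[R]_n) (u v : 'rV[R]_n) :
  eval2 b u v = \sum_i \sum_j b i j * u 0 i * v 0 j.
Proof.
rewrite /eval2 mxE exchange_big; apply: eq_bigr => j _; rewrite !mxE mulr_suml.
by apply: eq_bigr => i _; ring.
Qed.

Lemma eval2_tr n (b : 'M[R]_n) (u v : 'rV[R]_n) : eval2 b u v = eval2 b^T v u.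
Proof. by rewrite /eval2 -trace_mx11 -mxtrace_tr trace_mx11 !trmx_mul trmxK mulmxA. Qed.

Lemma extd_anti n (M : manifold R n) (w : oneForm M) (c : chart M) x u v :
  eval2 (extd w c x) u v = - eval2 (extd w c x) v u.
Proof.
rewrite eval2_tr /eval2.
suff -> : (extd w c x)^T = - extd w c x by rewrite mulmxN mulNmx mxE.
by apply/matrixP => i j; rewrite !mxE -mulrN opprB.
Qed.

Lemma extd_alt n (M : manifold R n) (w : oneForm M) (c : chart M) x u :
  eval2 (extd w c x) u u = 0.
Proof. by have := extd_anti w c x u u; lra. Qed.

Lemma eval1Z n (w : 'cV[R]_n) a u : eval1 w (a *: u) = a * eval1 w u.
Proof. by rewrite /eval1 -scalemxAl mxE. Qed.

Lemma eval1D n (w : 'cV[R]_n) u v : eval1 w (u + v) = eval1 w u + eval1 w v.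
Proof. by rewrite /eval1 mulmxDl mxE. Qed.

Lemma eval1N n (w : 'cV[R]_n) u : eval1 w (- u) = - eval1 w u.
Proof. by rewrite /eval1 mulNmx mxE. Qed.

(** Lowering the index of the Christoffel symbol turns the left-hand side into
    first derivatives of g contracted with X. The Leibniz rule applied to
    w = - g X produces the same terms on the right, up to the (i, j) component
    of the Lie derivative of g along X. In other words the covariant
    derivative of w has no symmetric part. *)
Lemma killing_christoffel n (M : manifold R n) (g : bilinearField M)
    (X : vectorField M) (w : oneForm M) (c : chart M) x :
  killing g X ->
  (forall y, img c y -> (g c y)^T = g c y) ->
  (forall y, img c y -> g c y \in unitmx) ->
  (forall y i, img c y -> w c y i 0 = - \sum_k g c y i k * X c y 0 k) ->
  img c x ->
  forall i j, \sum_k christoffel g c x k i j * w c x k 0 =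
    2^-1 * (partial i (fun y => w c y j 0) x + partial j (fun y => w c y i 0) x).
Proof.
move=> hK gT gU hw imgx i j.
have oimg : open (img c) by exact: img_open.
have gC k l : g c x k l = g c x l k by rewrite -{1}gT// mxE.
have dg : differentiable (g c) x by exact: (@bf_smooth _ _ _ g c [::] x imgx).
have dX : differentiable (X c) x by exact: (@vf_smooth _ _ _ X c [::] x imgx).
have dw a b : partial a (fun y => w c y b 0) x =
    - \sum_k (partial a (fun y => g c y b k) x * X c x 0 k +
              g c x b k * partial a (fun y => X c y 0 k) x).
  rewrite /partial (@near_eq_derive _ _ _ _
     (- \sum_k (fun y => g c y b k) * (fun y => X c y 0 k))); last first.
    apply: filterS (open_nbhs_nbhs (conj oimg imgx)) => y /hw ->.
    by rewrite fctE fct_sumE.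
  have dgk k : derivable (fun y => g c y b k) x (delta_mx 0 a).
    exact/diff_derivable/differentiable_entry.
  have dXk k : derivable (fun y => X c y 0 k) x (delta_mx 0 a).
    exact/diff_derivable/differentiable_entry.
  rewrite deriveN; last by apply: derivable_sum => k; exact: derivableM.
  rewrite derive_sum; last by move=> k; exact: derivableM.
  congr (- _); apply: eq_bigr => k _.
  by rewrite deriveM// addrC [X c x 0 k *: _]mulrC.
pose G l := partial i (fun y => g c y j l) x + partial j (fun y => g c y i l) x
     - partial l (fun y => g c y i j) x.
have -> : \sum_k christoffel g c x k i j * w c x k 0 = - (2^-1 * \sum_l G l * X c x 0 l).
  pose r : 'rV[R]_n := \row_l G l.
  have wE : w c x = - (g c x *m (X c x)^T).
    apply/matrixP => k l; rewrite ord1 hw// !mxE; congr (- _).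
    by apply: eq_bigr => m _; rewrite mxE.
  have : (r *m (invmx (g c x) *m w c x)) 0 0 = - (\sum_l G l * X c x 0 l).
    rewrite wE mulmxN mulKmx ?gU// mulmxN !mxE; congr (- _).
    by apply: eq_bigr => l _; rewrite !mxE.
  rewrite mulmxA mxE => e; rewrite -mulrN -e mulr_sumr.
  apply: eq_bigr => k _; rewrite /christoffel mulrA; congr (_ * _ * _).
  rewrite mxE; apply: eq_bigr => l _; rewrite mxE -/(G l) mulrC; congr (_ * _).
  by rewrite -[in LHS](gT x)// -trmx_inv mxE.
have /matrixP/(_ i j) := hK c x imgx; rewrite !mxE => hKij.
rewrite !dw -mulrN; congr (_ * _).
rewrite -opprD; congr (- _).
rewrite -big_split; apply/esym/subr0_eq; apply: etrans hKij; rewrite -sumrB /=.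
apply: eq_bigr => k _; rewrite /G (gC k j); ring.
Qed.

End BilinearAlgebra.

Section Sasakian.
Context {R : realType} (M : manifold R 3) (S : contactMetricLorentzian M).
Implicit Types (c : chart M) (x u v : 'rV[R]_3).

(** The compatibility axiom at v = xi: its left-hand side is
    d eta (u Phi, xi), which vanishes because xi is the Reeb field. *)
Lemma eta_metric c x u : img c x ->
  eval2 (metric S c x) u (xi S c x) = - eval1 (eta S c x) u.
Proof.
move=> imgx; have := cml_compatible S u (xi S c x) imgx.
rewrite -cml_deta// extd_anti cml_deta_xi// cml_eta_xi// mulr1 oppr0 => h.
by apply/eqP; rewrite -addr_eq0 -h.
Qed.

Lemma metric_sym c x : img c x -> (metric S c x)^T = metric S c x.
Proof. by case/(cml_lorentzian S). Qed.

Lemma metric_unit c x : img c x -> metric S c x \in unitmx.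
Proof.
case/(cml_lorentzian S) => _ [P Pu e].
have : P *m metric S c x *m P^T \in unitmx.
  rewrite e unitmxE det_diag unitfE; apply/prodf_neq0 => i _.
  by rewrite mxE; case: ifP => _; rewrite ?oppr_eq0 oner_eq0.
by rewrite unitmx_mul => /andP[]; rewrite unitmx_mul => /andP[].
Qed.

Lemma eta_Phi c x u : img c x -> eval1 (eta S c x) (u *m Phi S c x) = 0.
Proof.
move=> imgx; have := eta_metric (u *m Phi S c x) imgx.
rewrite eval2_tr metric_sym// -cml_deta// cml_deta_xi// => /eqP.
by rewrite eq_sym oppr_eq0 => /eqP.
Qed.

Lemma eta_wedge c x u v : img c x ->
  eval1 (eta S c x) (wedge S c x u v) = eval2 (extd (eta S) c x) u v.
Proof.
move=> imgx; rewrite /wedge !eval1D eval1N !eval1Z !eta_Phi// cml_eta_xi//.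
by rewrite cml_deta// !mulr0 oppr0 !addr0 mulr1.
Qed.

(** This is nabla_X xi = Phi X, written for eta instead of xi. *)
Lemma sasakian_nabla_eta c x i j : sasakian S -> img c x ->
  partial i (fun y => eta S c y j 0) x -
    \sum_k christoffel (metric S) c x k i j * eta S c x k 0 = extd (eta S) c x i j.
Proof.
move=> hS imgx.
rewrite (@killing_christoffel _ _ _ _ (xi S))//.
- by rewrite mxE; field.
- exact: metric_sym.
- exact: metric_unit.
move=> y k imgy.
have := eta_metric (delta_mx 0 k) imgy.
rewrite /eval2 /eval1 -!rowE mxE [in RHS]mxE => /(congr1 -%R); rewrite opprK => <-.
by congr (- _); apply: eq_bigr => l _; rewrite !mxE.
Qed.

End Sasakian.

(** * The contact form on the Frenet frame *)

Section Curves.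
Context {R : realType}.

Lemma curve_dom_nbhs n (M : manifold R n) (I : set R) (alpha : R -> M)
    (c : chart M) t :
  open I -> (forall s, I s -> {for s, continuous alpha}) -> curve_dom I alpha c t ->
  nbhs t (curve_dom I alpha c).
Proof.
move=> oI ca [It domt]; apply: filterI; first exact: open_nbhs_nbhs.
by apply: ca => //; apply: open_nbhs_nbhs; split => //; exact: dom_open.
Qed.

Context (M : manifold R 3) (S : contactMetricLorentzian M).
Context (I : set R) (alpha : R -> M).
Hypotheses (hS : sasakian S) (ha : smooth_curve I alpha).

Lemma velocity_smooth (c : chart M) : smooth_on (curve_dom I alpha c) (velocity alpha c).
Proof.
move=> s t ht; have [_ sa] := ha.
have -> : velocity alpha c = 'D_1 (chart_map c \o alpha).
  by apply/funext => r; rewrite /velocity derive1E.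
by have := sa c (rcons s 1) t ht; rewrite foldr_rcons.
Qed.

Lemma img_curve (c : chart M) t : curve_dom I alpha c t -> img c (chart_map c (alpha t)).
Proof. by case=> _ ?; exists (alpha t). Qed.

Lemma eta_diff (c : chart M) x : img c x -> differentiable (eta S c) x.
Proof. exact: (@of_smooth _ _ _ (eta S) c [::] x). Qed.

Lemma is_derive_eta_dpairing (V : chart M -> R -> 'rV[R]_3) (c : chart M) t :
  curve_dom I alpha c t -> differentiable (V c) t ->
  is_derive t (1 : R) (eta_along S alpha V c)
    (dpairing (eta S c) (chart_map c \o alpha) (V c) t).
Proof.
move=> ht dV; apply: is_derive_pairing => //.
  exact/eta_diff/img_curve.
exact: (ha.2 c [::] t ht).
Qed.

(** The terms with a derivative of V are the same in (eta V)' and in eta (D V);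
    the others differ by the covariant derivative of eta at (T, V), which is
    d eta (T, V). *)
Lemma is_derive_eta_along (V : chart M -> R -> 'rV[R]_3) (c : chart M) t :
  curve_dom I alpha c t -> differentiable (V c) t ->
  is_derive t (1 : R) (eta_along S alpha V c)
    (eval1 (eta S c (chart_map c (alpha t))) (cov_deriv (metric S) alpha V c t) +
     eval2 (extd (eta S) c (chart_map c (alpha t))) (velocity alpha c t) (V c t)).
Proof.
move=> ht dV; apply: (is_derive_eq (is_derive_eta_dpairing ht dV)).
have imgt := img_curve ht; have dw := eta_diff imgt.
set x := chart_map c (alpha t) in imgt dw *.
rewrite eval2_sum /eval1 mxE /dpairing big_split/=.
under [X in _ = X + _]eq_bigr => k _ do rewrite mxE mulrDl.
rewrite big_split/= -addrA; congr (_ + _).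
rewrite -/x -/(velocity alpha c t).
transitivity (\sum_i \sum_j (velocity alpha c t 0 i * V c t 0 j *
  partial i (fun y => eta S c y j 0) x)).
  rewrite exchange_big; apply: eq_bigr => j _; rewrite mulr_sumr.
  by apply: eq_bigr => i _; rewrite derive_entry// /partial; ring.
rewrite [X in _ = X + _](_ : _ = \sum_i \sum_j (velocity alpha c t 0 i * V c t 0 j *
    \sum_k christoffel (metric S) c x k i j * eta S c x k 0)); last first.
  under eq_bigr do rewrite mulr_suml.
  rewrite exchange_big; apply: eq_bigr => i _.
  under eq_bigr do rewrite mulr_suml.
  rewrite exchange_big; apply: eq_bigr => j _; rewrite mulr_sumr.
  by apply: eq_bigr => k _; ring.
rewrite -big_split; apply: eq_bigr => i _; rewrite -big_split/=.
by apply: eq_bigr => j _; rewrite -(sasakian_nabla_eta i j hS imgt)//; ring.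
Qed.

Lemma derivable_eta_velocity (c : chart M) t : curve_dom I alpha c t ->
  derivable (dpairing (eta S c) (chart_map c \o alpha) (velocity alpha c)) t (1 : R).
Proof.
move=> ht; have imgt := img_curve ht.
have dx : differentiable (velocity alpha c) t := velocity_smooth [::] ht.
apply: derivable_dpairing => //.
- by move=> v; apply: (@of_smooth _ _ _ (eta S) c [:: v]).
- exact: eta_diff.
- exact: (ha.2 c [::] t ht).
have -> : derive1 (velocity alpha c) = 'D_1 (velocity alpha c).
  by apply/funext => r; rewrite derive1E.
exact: (velocity_smooth [:: 1] ht).
Qed.

(** The shift from tau to tau - 1 comes from d eta (T, N) = e3 eta (B) and
    d eta (B, T) = e2 eta (N). *)
Lemma frenet_eta (N B : chart M -> R -> 'rV[R]_3) (e1 e2 e3 : R) (kappa tau : R -> R)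
    (c : chart M) t :
  frenet_curve S I alpha N B e1 e2 e3 kappa tau -> curve_dom I alpha c t ->
  let a := eta_along S alpha (velocity alpha) c in
  let b := eta_along S alpha N c in
  let d := eta_along S alpha B c in
  [/\ is_derive t (1 : R) a (e2 * kappa t * b t),
      is_derive t (1 : R) b (- (e1 * kappa t * a t) - e3 * (tau t - 1) * d t) &
      is_derive t (1 : R) d (e2 * (tau t - 1) * b t)].
Proof.
move=> hF ht a b d; have imgt := img_curve ht.
have [DT DN DB] := fc_frenet hF ht.
have [TN _ BT] := fc_oriented hF ht.
have hTN := eta_wedge S (velocity alpha c t) (N c t) imgt.
have hBT := eta_wedge S (B c t) (velocity alpha c t) imgt.
split; apply: is_derive_eq.
- by apply: is_derive_eta_along => //; apply: (velocity_smooth [::] ht).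
- by rewrite DT eval1Z extd_alt addr0.
- by apply: is_derive_eta_along => //; apply: ((fc_N hF).1 c [::] t ht).
- rewrite DN -hTN [wedge _ _ _ _ _]TN eval1D eval1N scaleNr eval1N !eval1Z.
  by rewrite /a /d /eta_along; ring.
- by apply: is_derive_eta_along => //; apply: ((fc_B hF).1 c [::] t ht).
rewrite DB extd_anti -hBT [wedge _ _ _ _ _]BT !eval1Z.
by rewrite /b /eta_along; ring.
Qed.

End Curves.

(** * The torsion of a contact whirl curve *)

Section Whirl.
Context {R : realType}.

(** The system determines tau: both expressions of b', from the second equation
    and from b = a / rho, give d (tau - 1) = - e3 A kappa a, and the formula is
    the derivative of this relation with b and d eliminated. The hypotheses
    hold on an open set, because the relations that are differentiated must
    hold near t. *)
Lemma whirl_torsion_ode (U : set R) (a b d kappa tau : R -> R) (e1 e2 e3 rho dk t : R) :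
  open U -> U t -> rho != 0 -> e2 ^+ 2 = 1 -> e3 ^+ 2 = 1 ->
  (forall s, U s -> a s = rho * b s) -> (forall s, U s -> a s != 0) ->
  (forall s, U s -> tau s != 1) -> (forall s, U s -> kappa s != 0) ->
  (forall s, U s -> is_derive s (1 : R) a (e2 * kappa s * b s)) ->
  (forall s, U s ->
    is_derive s (1 : R) b (- (e1 * kappa s * a s) - e3 * (tau s - 1) * d s)) ->
  (forall s, U s -> is_derive s (1 : R) d (e2 * (tau s - 1) * b s)) ->
  is_derive t (1 : R) kappa dk ->
  let A := e1 + e2 / rho ^+ 2 in
  A != 0 ->
  is_derive t (1 : R) tau
    ((tau t - 1) * (e2 * e3 / (rho * kappa t * A) * (tau t - 1) ^+ 2
                    + dk / kappa t + e2 / rho * kappa t)).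
Proof.
move=> oU Ut rho0 e22 e32 ab a0 tau1 kappa0 da db dd dkappa A A0.
have e30 : e3 != 0 by rewrite -sqrf_eq0 e32 oner_eq0.
(* b' computed from the system must be a' / rho. *)
have slope s : U s -> d s * (tau s - 1) = - (e3 * A * kappa s * a s).
  move=> Us.
  have e : e2 * kappa s * b s =
      rho * (- (e1 * kappa s * a s) - e3 * (tau s - 1) * d s).
    apply: (is_derive_inj (f := a) (t := s)); first exact: da.
    apply: (@near_eq_is_derive _ _ _ (fun s => rho * b s)).
      by apply: filterS (open_nbhs_nbhs (conj oU Us)) => r /ab.
    exact: (is_deriveZ rho (db s Us)).
  have eb : b s = a s / rho by rewrite ab// mulrAC divff ?mul1r.
  have : e3 * (d s * (tau s - 1)) = - (A * kappa s * a s).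
    apply: (mulfI rho0); rewrite eb in e; rewrite /A.
    have -> : rho * (e3 * (d s * (tau s - 1))) =
      - (rho * (- (e1 * kappa s * a s) - e3 * (tau s - 1) * d s)) - rho * e1 * kappa s * a s.
      by ring.
    by rewrite -e; field.
  move=> /(congr1 ( *%R e3)); rewrite mulrA -expr2 e32 mul1r => ->; ring.
have d0 s : U s -> d s != 0.
  move=> Us; apply/eqP => ds0; have := slope s Us.
  rewrite ds0 mul0r => /eqP; rewrite eq_sym oppr_eq0 !mulf_eq0.
  by rewrite (negPf e30) (negPf A0) (negPf (kappa0 s Us)) (negPf (a0 s Us)).
have ddt : is_derive t (1 : R) (fun s => (d s)^-1)
    (- (d t) ^- 2 * (e2 * (tau t - 1) * b t)).
  have [h1 h2] := dd t Ut; rewrite -h2.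
  by apply: DeriveDef; [exact: derivableV (d0 t Ut) h1|exact: deriveV (d0 t Ut) h1].
have h := is_derive_mul (is_derive_mul dkappa (da t Ut)) ddt.
have h' := is_deriveD (is_derive_cst (1 : R) t 1) (is_deriveZ (- (e3 * A)) h).
(* h' differentiates 1 - e3 A kappa a / d, which is tau near t by slope. *)
apply: (@near_eq_is_derive _ _ _ _ _ _ _ _ _ (is_derive_eq h' _)).
  apply: filterS (open_nbhs_nbhs (conj oU Ut)) => s Us.
  have /(congr1 (fun z => 1 + z / d s)) := slope s Us.
  rewrite [d s * _]mulrC mulfK ?d0// addrC subrK => ->.
  by rewrite !fctE /= /GRing.scale /=; ring.
have eb : b t = a t / rho by rewrite ab// mulrAC divff ?mul1r.
have t0 : tau t - 1 != 0 by rewrite subr_eq0 tau1.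
have dE : d t = - (e3 * A * kappa t * a t) / (tau t - 1).
  by rewrite -slope// mulfK.
have e3V : e3^-1 = e3 by apply: (mulfI e30); rewrite divff// -expr2.
have at0 := a0 t Ut; have kt0 := kappa0 t Ut.
(* The claim is a rational identity once e3 ^ 2 = 1 is used; writing one e3 as
   its inverse makes it hold for every nonzero e3. *)
rewrite -[X in _ = _ * (e2 * X / _ * _ + _ + _)]e3V.
rewrite /GRing.scale /= dE eb.
clearbody A.
by field; rewrite rho0 kt0 A0 e30 t0 at0.
Qed.

End Whirl.

Unset Implicit Arguments.
Set Strict Implicit.

Theorem proposition3p1 (R : realType) (M : manifold R 3)
    (S : contactMetricLorentzian M) (hS : sasakian S)
    (I : set R) (I_open : open I) (I_itv : is_interval I)
    (alpha : R -> M) (N B : chart M -> R -> 'rV[R]_3)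
    (e1 e2 e3 : R) (kappa tau : R -> R)
    (hF : frenet_curve S I alpha N B e1 e2 e3 kappa tau)
    (rho : R) (hW : contact_whirl S I alpha N rho)
    (J : set R) (J_open : open J) (J_itv : is_interval J) (JI : J `<=` I)
    (etaT : forall c t, curve_dom J alpha c t ->
      eta_along S alpha (velocity alpha) c t != 0)
    (tau1 : forall t, J t -> tau t != 1) :
  let A := e1 + e2 / rho ^+ 2 in
  A != 0 ->
  forall t, J t ->
    is_derive t (1 : R) tau
      ((tau t - 1) * (e2 * e3 / (rho * kappa t * A) * (tau t - 1) ^+ 2
                      + derive1 kappa t / kappa t + e2 / rho * kappa t)).
Proof.
move=> A A0 t Jt; have ha := fc_smooth hF; have [rho0 hrho] := hW.
have sq1 (e : R) : e = 1 \/ e = -1 -> e ^+ 2 = 1.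
  by case=> ->; rewrite ?sqrrN expr1n.
(* A single chart suffices: the claim is local in t. *)
have [c domc] := dom_cover (alpha t).
pose U := interior (curve_dom J alpha c).
have UJ s : U s -> curve_dom J alpha c s by exact: interior_subset.
have UI s : U s -> curve_dom I alpha c s by move=> /UJ[/JI].
have Ut : U t.
  by apply: curve_dom_nbhs => // s /JI; exact: ha.1.
set a := eta_along S alpha (velocity alpha) c in etaT *.
pose b := eta_along S alpha N c; pose d := eta_along S alpha B c.
have ab s : U s -> a s = rho * b s by move=> /UI; exact: hrho.
have a0 s : U s -> a s != 0 by move=> /UJ; exact: etaT.
have b0 s : U s -> b s != 0.
  by move=> Us; have := a0 s Us; rewrite ab// mulf_eq0 => /norP[].
have ode s (Us : U s) := frenet_eta hS ha hF (UI s Us).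
(* kappa inherits its regularity from the first equation of the system, solved
   for kappa with a' in its explicit form q. *)
pose q := dpairing (eta S c) (chart_map c \o alpha) (velocity alpha c).
have kappaE s : U s -> e2 * q s * (b s)^-1 = kappa s.
  move=> Us; have [da _ _] := ode s Us.
  have dx : differentiable (velocity alpha c) s := velocity_smooth ha [::] (UI s Us).
  have -> : q s = e2 * kappa s * b s.
    exact: is_derive_inj (is_derive_eta_dpairing _ ha (UI s Us) dx) da.
  by rewrite !mulrA -expr2 (sq1 _ (fc_e2 hF)) mul1r mulfK ?b0.
have dkappa : derivable kappa t (1 : R).
  apply: (@near_eq_derivable _ _ _ (fun s => e2 * q s * (b s)^-1)).
    by apply: filterS (open_nbhs_nbhs (conj (open_interior _) Ut)) => s; exact: kappaE.
  have [_ [db _] _] := ode t Ut.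
  apply: derivableM; last exact: derivableV (b0 t Ut) db.
  by apply: derivableM; [exact: derivable_cst|exact: derivable_eta_velocity (UI t Ut)].
apply: (@whirl_torsion_ode _ U a b d kappa tau e1) => //.
- exact: open_interior.
- exact/sq1/(fc_e2 hF).
- exact/sq1/(fc_e3 hF).
- by move=> s /UJ[/tau1].
- by move=> s /UI[Is _]; rewrite gt_eqF// (fc_kappa hF).
- by move=> s /ode[].
- by move=> s /ode[].
- by move=> s /ode[].
by rewrite derive1E; exact: derivableP.
Qed.
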